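(* Let $k$ be an algebraically closed field of characteristic $0$ and $R=k\langle x,y\rangle/(xy-yx-y^2)$. Let $M$ be an indecomposable finite dimensional $R$-module, corresponding to a representation $\rho:R\to\mathrm{End}(k^n)$, and let $A_n=\rho(R)$ be the image of this representation. Then $A_n$ is a local algebra, i.e. $A_n/J(A_n)= k$, where $J(A_n)$ is the Jacobson radical of $A_n$. *)

(* Defs.v *)
From HB Require Import structures.
From mathcomp Require Import all_boot all_order all_algebra.
From mathcomp Require Import boolp.
From mathcomp Require Import monalg.

Set Implicit Arguments.
Unset Strict Implicit.
Unset Printing Implicit Defensive.

Import GRing.Theory.
Local Open Scope ring_scope.
Local Open Scope quotient_scope.

(* Two-sided ideals and the corresponding quotients. An ideal may be the whole
   ring, so a quotient is a possibly trivial ring (pzRingType). *)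

Definition ideal_closed (A : pzRingType) (I : {pred A}) : Prop :=
  [/\ zmod_closed I,
      forall a, {in I, forall u, a * u \in I} &
      forall a, {in I, forall u, u * a \in I}].

HB.mixin Record isTwoSided (A : pzRingType) (I : A -> bool) := {
  idealMl : forall a, {in I, forall u, a * u \in I};
  idealMr : forall a, {in I, forall u, u * a \in I}
}.

#[short(type="ideal")]
HB.structure Definition Ideal (A : pzRingType) :=
  {I of GRing.ZmodClosed A I & isTwoSided A I}.

Section RingQuotient.
Variables (A : pzRingType) (I : ideal A).

Definition rquot := Quotient.quot I.

HB.instance Definition _ := GRing.Zmodule.on rquot.
HB.instance Definition _ := Quotient.on rquot.

Definition rquot_one := lift_cst rquot 1.
Definition rquot_mul := lift_op2 rquot *%R.

Lemma rquot_eqP (a b : A) :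
  reflect (\pi_rquot a = \pi_rquot b) (a - b \in (I : {pred A})).
Proof. by rewrite Quotient.idealrBE; apply: eqP. Qed.

Lemma rquot_mulE (a b : A) :
  rquot_mul (\pi_rquot a) (\pi_rquot b) = \pi_rquot (a * b).
Proof.
unlock rquot_mul; apply/esym/rquot_eqP; set a' := repr (\pi a); set b' := repr (\pi b).
have Ha : a - a' \in (I : {pred A}) by apply/rquot_eqP; rewrite reprK.
have Hb : b - b' \in (I : {pred A}) by apply/rquot_eqP; rewrite reprK.
have -> : a * b - a' * b' = (a - a') * b + a' * (b - b').
  by rewrite mulrBl mulrBr addrA subrK.
by apply: rpredD; [exact: idealMr | exact: idealMl].
Qed.

Lemma rquot_piD (a b : A) :
  \pi_rquot (a + b) = \pi_rquot a + \pi_rquot b :> rquot.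
Proof. exact: (raddfD (\pi_(Quotient.quot I))). Qed.

Lemma rquot_oneE : rquot_one = \pi_rquot 1.
Proof. by unlock rquot_one. Qed.

Lemma rquot_mulA : associative rquot_mul.
Proof. by do 3!elim/quotW=> ?; rewrite !rquot_mulE mulrA. Qed.
Lemma rquot_mul1l : left_id rquot_one rquot_mul.
Proof. by elim/quotW=> a; rewrite rquot_oneE rquot_mulE mul1r. Qed.
Lemma rquot_mul1r : right_id rquot_one rquot_mul.
Proof. by elim/quotW=> a; rewrite rquot_oneE rquot_mulE mulr1. Qed.
Lemma rquot_mulDl : left_distributive rquot_mul +%R.
Proof.
by do 3!elim/quotW=> ?; rewrite -rquot_piD !rquot_mulE -rquot_piD mulrDl.
Qed.
Lemma rquot_mulDr : right_distributive rquot_mul +%R.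
Proof.
by do 3!elim/quotW=> ?; rewrite -rquot_piD !rquot_mulE -rquot_piD mulrDr.
Qed.

Lemma rquot_pi0 : \pi_rquot 0 = 0 :> rquot.
Proof. exact: (raddf0 (\pi_(Quotient.quot I))). Qed.

HB.instance Definition _ := GRing.Zmodule_isPzRing.Build rquot
  rquot_mulA rquot_mul1l rquot_mul1r rquot_mulDl rquot_mulDr.

End RingQuotient.

Section AlgQuotient.
Variables (k : comNzRingType) (A : algType k) (I : ideal A).

Local Notation Q := (rquot I).

Definition rquot_scale (c : k) := lift_op1 Q ( *:%R c).

Lemma rquot_scaleE (c : k) (a : A) : rquot_scale c (\pi_Q a) = \pi_Q (c *: a).
Proof.
unlock rquot_scale; apply/esym/rquot_eqP; rewrite -scalerBr -[_ - _]mul1r scalerAl.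
by apply: idealMl; apply/rquot_eqP; rewrite reprK.
Qed.

Lemma rquot_scaleA c d u :
  rquot_scale c (rquot_scale d u) = rquot_scale (c * d) u.
Proof. by elim/quotW: u => a; rewrite !rquot_scaleE scalerA. Qed.
Lemma rquot_scale1 : left_id 1 rquot_scale.
Proof. by elim/quotW=> a; rewrite rquot_scaleE scale1r. Qed.
Lemma rquot_scaleDr : right_distributive rquot_scale +%R.
Proof.
move=> c; do 2!elim/quotW=> ?.
by rewrite -rquot_piD !rquot_scaleE -rquot_piD scalerDr.
Qed.
Lemma rquot_scaleDl u : {morph rquot_scale^~ u : c d / c + d}.
Proof.
by elim/quotW: u => a c d; rewrite !rquot_scaleE -rquot_piD scalerDl.
Qed.

HB.instance Definition _ := GRing.Zmodule_isLmodule.Build k Q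
  rquot_scaleA rquot_scale1 rquot_scaleDr rquot_scaleDl.

Lemma rquot_scaleAl (c : k) (u v : Q) : c *: (u * v) = (c *: u) * v.
Proof.
elim/quotW: u => a; elim/quotW: v => b.
rewrite -[LHS]/(rquot_scale _ (rquot_mul _ _)).
rewrite -[RHS]/(rquot_mul (rquot_scale _ _) _).
by rewrite rquot_mulE !rquot_scaleE rquot_mulE scalerAl.
Qed.
Lemma rquot_scaleAr (c : k) (u v : Q) : c *: (u * v) = u * (c *: v).
Proof.
elim/quotW: u => a; elim/quotW: v => b.
rewrite -[LHS]/(rquot_scale _ (rquot_mul _ _)).
rewrite -[RHS]/(rquot_mul _ (rquot_scale _ _)).
by rewrite rquot_mulE !rquot_scaleE rquot_mulE scalerAr.
Qed.

End AlgQuotient.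

Section GeneratedIdeal.
Variables (A : pzRingType) (S : {pred A}).

Definition ideal_gen : {pred A} :=
  fun a => `[< forall I : {pred A},
                 ideal_closed I -> {subset S <= I} -> a \in I >].

Lemma ideal_genP (a : A) :
  reflect (forall I : {pred A}, ideal_closed I -> {subset S <= I} -> a \in I)
          (a \in ideal_gen).
Proof. exact: asboolP. Qed.

Lemma ideal_gen_zmod : zmod_closed ideal_gen.
Proof.
split=> [|a b /ideal_genP ha /ideal_genP hb].
  by apply/ideal_genP=> I [[]].
apply/ideal_genP=> I hI hS; have [[_ hB] _ _] := hI.
by rewrite hB ?ha ?hb.
Qed.
Lemma ideal_genMl a : {in ideal_gen, forall u, a * u \in ideal_gen}.
Proof.
move=> u /ideal_genP hu; apply/ideal_genP=> I hI hS.
by have [_ hl _] := hI; rewrite hl ?hu.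
Qed.
Lemma ideal_genMr a : {in ideal_gen, forall u, u * a \in ideal_gen}.
Proof.
move=> u /ideal_genP hu; apply/ideal_genP=> I hI hS.
by have [_ _ hr] := hI; rewrite hr ?hu.
Qed.

HB.instance Definition _ := GRing.isZmodClosed.Build A ideal_gen ideal_gen_zmod.
HB.instance Definition _ := isTwoSided.Build A ideal_gen ideal_genMl ideal_genMr.

End GeneratedIdeal.

(* The free algebra on a set X of generators, as the monoid algebra of the
   words on X. *)

Definition word (X : choiceType) := seq X.
HB.instance Definition _ (X : choiceType) := Choice.on (word X).

Lemma word_unit (X : choiceType) (u v : word X) :
  (u ++ v : word X) = [::] -> u = [::] /\ v = [::].
Proof. by case: u. Qed.

HB.instance Definition _ (X : choiceType) :=
  Choice_isMonomialDef.Build (word X)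
    (@catA X) (@cat0s X) (@cats0 X) (@word_unit X).

Definition free_alg (k : comNzRingType) (X : choiceType) := {malg k[word X]}.

Section FreeAlg.
Variables (k : comNzRingType) (X : choiceType).
Local Notation F := (free_alg k X).

HB.instance Definition _ := GRing.Lalgebra.on F.

Lemma free_scaleAr (c : k) (f g : F) : c *: (f * g) = f * (c *: g).
Proof.
apply/malgP=> w; rewrite mcoeffZ.
rewrite (mcoeffMlw (d1 := msupp f) (d2 := msupp g)) //.
rewrite (mcoeffMlw (g2 := c *: g) (d1 := msupp f) (d2 := msupp g)) //;
  last exact: msuppZ_le.
rewrite mulr_sumr; apply: eq_bigr => u _; rewrite mulr_sumr.
by apply: eq_bigr => v _; rewrite mcoeffZ mulrnAr mulrCA.
Qed.

HB.instance Definition _ := GRing.Lalgebra_isAlgebra.Build k F free_scaleAr.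

Definition free_gen (i : X) : F := << ([:: i] : word X) >>.

End FreeAlg.

Section JordanPlane.
Variable k : fieldType.

Local Notation F := (free_alg k 'I_2).
Definition free_x : F := free_gen k ord0.
Definition free_y : F := free_gen k ord_max.

Definition jordan_ideal : ideal F :=
  ideal_gen (pred1 (free_x * free_y - free_y * free_x - free_y ^+ 2)).

Definition jordan_plane := rquot jordan_ideal.

HB.instance Definition _ := GRing.PzRing.on jordan_plane.
HB.instance Definition _ := GRing.Lmodule.on jordan_plane.

(* The relation has no constant term, hence neither has any element of the
   ideal. *)
Lemma jordan_one_neq0 : 1 != 0 :> jordan_plane.
Proof.
rewrite -[1]/(rquot_one _) rquot_oneE -[0]/(0 : rquot _) -rquot_pi0.
apply/eqP=> /rquot_eqP; rewrite subr0 => /ideal_genP.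
pose aug : {rmorphism F -> k} := @mcoeff (word 'I_2) k mone.
move=> /(_ [pred f | aug f == 0]) h.
suff: (1 : F) \in [pred f | aug f == 0] by rewrite inE rmorph1 oner_eq0.
apply: h => [|f]; last first.
  rewrite !inE => /eqP ->; apply/eqP.
  have: aug free_y = 0 by exact: mcoeffU1.
  move: free_x free_y aug => x y aug y0.
  by rewrite 2!rmorphB rmorphXn 2!rmorphM y0 mulr0 mul0r expr0n !subr0.
split=> [|f g|f g]; first split=> [|f g]; rewrite ?inE.
- by rewrite rmorph0.
- by move=> /eqP f0 /eqP g0; rewrite rmorphB f0 g0 subr0.
- by move=> /eqP g0; rewrite rmorphM g0 mulr0.
- by move=> /eqP g0; rewrite rmorphM g0 mul0r.
Qed.

HB.instance Definition _ :=
  GRing.PzSemiRing_isNonZero.Build jordan_plane jordan_one_neq0.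
HB.instance Definition _ := GRing.Lmodule_isLalgebra.Build k jordan_plane
  (@rquot_scaleAl k F jordan_ideal).
HB.instance Definition _ := GRing.Lalgebra_isAlgebra.Build k jordan_plane
  (@rquot_scaleAr k F jordan_ideal).

End JordanPlane.

(* The Jacobson radical, as the intersection of the maximal left ideals. *)

Section Jacobson.
Variable A : pzRingType.

Definition left_ideal (I : {pred A}) : Prop :=
  zmod_closed I /\ forall a, {in I, forall u, a * u \in I}.

Definition maximal_left_ideal (m : {pred A}) : Prop :=
  [/\ left_ideal m, 1 \notin m &
      forall I : {pred A}, left_ideal I -> 1 \notin I ->
        {subset m <= I} -> {subset I <= m}].

Definition jacobson : {pred A} :=
  fun a => `[< forall m : {pred A}, maximal_left_ideal m -> a \in m >].

Lemma jacobsonP (a : A) :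
  reflect (forall m : {pred A}, maximal_left_ideal m -> a \in m)
          (a \in jacobson).
Proof. exact: asboolP. Qed.

Lemma left_ideal1 (I : {pred A}) a : left_ideal I -> 1 \in I -> a \in I.
Proof. by move=> [_ Il] I1; rewrite -[a]mulr1 Il. Qed.

Lemma left_idealD (I : {pred A}) :
  left_ideal I -> {in I &, forall u v, u + v \in I}.
Proof.
move=> [[I0 IB] _] u v Iu Iv; rewrite -[v]opprK IB // -[- v]add0r IB //.
Qed.

(* The left ideal (m : a) is maximal as soon as it is proper. *)
Lemma maximal_left_ideal_colon (m : {pred A}) a :
  maximal_left_ideal m -> a \notin m ->
  maximal_left_ideal [pred u | u * a \in m].
Proof.
move=> [mI m1 mmax] am; have [[m0 mB] ml] := mI.
split=> [||I II I1 sub u Iu].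
- split=> [|b u]; last by rewrite !inE -mulrA; exact: ml.
  by split=> [|u v]; rewrite !inE ?mul0r // mulrBl; exact: mB.
- by rewrite inE mul1r.
have [[I0 IB] Il] := II.
apply: contraT; rewrite inE => uam.
pose J : {pred A} :=
  fun x => `[< exists2 y, y \in m & exists b, x = y + b * (u * a) >].
have JI : left_ideal J.
  split=> [|b x /asboolP[y ym [c ->]]]; last first.
    apply/asboolP; exists (b * y); first exact: ml.
    by exists (b * c); rewrite mulrDr !mulrA.
  split=> [|x x' /asboolP[y ym [c ->]] /asboolP[y' ym' [c' ->]]].
    by apply/asboolP; exists 0 => //; exists 0; rewrite mul0r addr0.
  apply/asboolP; exists (y - y'); first exact: mB.
  by exists (c - c'); rewrite mulrBl opprD addrACA.
have mJ : {subset m <= J}.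
  by move=> y ym; apply/asboolP; exists y => //; exists 0; rewrite mul0r addr0.
have uaJ : u * a \in J.
  by apply/asboolP; exists 0 => //; exists 1; rewrite mul1r add0r.
have [J1|J1] := boolP (1 \in J); last by rewrite (mmax J) in uam.
have /asboolP[y ym [b aE]] : a \in J by exact: left_ideal1.
have cI : 1 - b * u \in I.
  by apply: sub; rewrite inE mulrBl mul1r -mulrA {1}aE addrK.
case/negP: I1; rewrite -[1](subrK (b * u)).
by apply: left_idealD => //; exact: Il.
Qed.

Lemma jacobson_zmod : zmod_closed jacobson.
Proof.
split=> [|a b /jacobsonP ha /jacobsonP hb]; apply/jacobsonP => m hm;
  have [[[m0 mB] _] _ _] := hm => //.
by apply: mB; [exact: ha | exact: hb].
Qed.

Lemma jacobsonMl a : {in jacobson, forall u, a * u \in jacobson}.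
Proof.
move=> u /jacobsonP hu; apply/jacobsonP => m hm.
by have [[_ ml] _ _] := hm; apply: ml; exact: hu.
Qed.

Lemma jacobsonMr a : {in jacobson, forall u, u * a \in jacobson}.
Proof.
move=> u /jacobsonP hu; apply/jacobsonP => m hm.
have [am|am] := boolP (a \in m); last exact: hu (maximal_left_ideal_colon hm am).
by have [[_ ml] _ _] := hm; exact: ml.
Qed.

HB.instance Definition _ := GRing.isZmodClosed.Build A jacobson jacobson_zmod.
HB.instance Definition _ := isTwoSided.Build A jacobson jacobsonMl jacobsonMr.

End Jacobson.

Arguments jacobson : clear implicits.

(* A / J(A) = k, as k-algebras. *)
Definition local_algebra (k : fieldType) (A : algType k) : Prop :=
  exists f : {linear rquot (jacobson A) -> k^o},
    monoid_morphism (f : rquot (jacobson A) -> k) /\ bijective f.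

Section Image.
Variables (k : fieldType) (A B : algType k) (f : {lrmorphism A -> B}).

Definition lr_image : {pred B} := fun b => `[< exists a, f a = b >].

Lemma lr_image_subalg : subalg_closed lr_image.
Proof.
split=> [|c _ _ /asboolP[a <-] /asboolP[a' <-]|
           _ _ /asboolP[a <-] /asboolP[a' <-]]; apply/asboolP.
- by exists 1; rewrite rmorph1.
- by exists (c *: a + a'); rewrite linearP.
- by exists (a * a'); rewrite rmorphM.
Qed.

HB.instance Definition _ := GRing.isSubalgClosed.Build k B lr_image
  lr_image_subalg.

Definition image_alg := {b : B | b \in lr_image}.

HB.instance Definition _ := [isSub of image_alg for @sval B _].
HB.instance Definition _ := [Choice of image_alg by <:].
HB.instance Definition _ := [SubChoice_isSubAlgebra of image_alg by <:].

End Image.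

Section Modules.
Variable R : pzRingType.

Definition module_iso (M N : lmodType R) : Prop :=
  exists f : {linear M -> N}, bijective f.

Definition direct_sum (M : lmodType R) (U V : {pred M}) : Prop :=
  (forall x, exists2 u, u \in U & exists2 v, v \in V & x = u + v) /\
  (forall x, x \in U -> x \in V -> x = 0).

Definition indecomposable (M : lmodType R) : Prop :=
  (exists x : M, x != 0) /\
  forall U V : {pred M}, submod_closed U -> submod_closed V ->
    direct_sum U V ->
    (forall u, u \in U -> u = 0) \/ (forall v, v \in V -> v = 0).

End Modules.

(* The module afforded by a representation: column vectors, with r acting as
   the matrix rho r. *)
Section RepModule.
Variables (k : fieldType) (R : algType k) (n : nat).
Variable rho : {lrmorphism R -> 'M[k]_n.+1}.

Definition rep_module := let _ := rho in 'cV[k]_n.+1.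

HB.instance Definition _ := GRing.Zmodule.on rep_module.

Definition rep_act (r : R) (v : rep_module) : rep_module := rho r *m v.

Lemma rep_actA r s v : rep_act r (rep_act s v) = rep_act (r * s) v.
Proof. by rewrite /rep_act rmorphM mulmxA. Qed.
Lemma rep_act1 : left_id 1 rep_act.
Proof. by move=> v; rewrite /rep_act rmorph1 mul1mx. Qed.
Lemma rep_actDr : right_distributive rep_act +%R.
Proof. by move=> r u v; rewrite /rep_act mulmxDr. Qed.
Lemma rep_actDl v : {morph rep_act^~ v : r s / r + s}.
Proof. by move=> r s; rewrite /rep_act rmorphD mulmxDl. Qed.

HB.instance Definition _ := GRing.Zmodule_isLmodule.Build R rep_module
  rep_actA rep_act1 rep_actDr rep_actDl.

End RepModule.

(* Main.v *)
From HB Require Import structures.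
Require Import Defs.
From mathcomp Require Import all_boot all_order all_algebra.
From mathcomp Require Import boolp monalg.

(** Write X and Y for the matrices of x and y, so that XY - YX = Y^2, and A
    for the algebra they generate.

    In characteristic 0 the matrix Y is nilpotent: the derivation [X, -] sends
    p(Y) to p'(Y) Y^2, so the minimal polynomial p of Y divides p' t^2, which
    leaves no room for a nonzero root ([jordan_relation_nilpotent]).

    Two facts about the Jordan plane then govern everything: commutators of
    arbitrary elements with y lie in the right ideal y^2 R
    ([jordan_y_normal]), and all commutators lie in y R
    ([jordan_comm_mod_y]).  Moving b past the successive powers of y gives
    b^i c = d b + y^i e for suitable d and e ([expr_ore]).  Since a power of Y
    vanishes, a power of B = rho b satisfies B^m A <= A B, whence the
    generalized kernel of every element of A is a submodule
    ([gen_ker_submod]).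

    Fitting's lemma follows: if the characteristic polynomial of B is q t^l
    with q(0) != 0, the module is the direct sum of the generalized kernels of
    B and of q(B).  By indecomposability one of them is 0, so that a singular
    element of A is nilpotent ([nilpotent_of_singular]).  Applied to X - a, for
    a an eigenvalue of X, this makes X - a nilpotent.  Killing a row vector
    first by Y and then by X - a produces a common left eigenvector w
    ([jordan_common_eigenvector]).

    The eigenvalues on w form a character A -> k.  An element of its kernel is
    singular because it kills w, hence nilpotent; so the kernel is a two-sided
    ideal of nilpotent elements of codimension 1, and it is the Jacobson
    radical ([jacobson_ker], [local_algebra_of_character]). *)

Set Implicit Arguments.
Unset Strict Implicit.
Unset Printing Implicit Defensive.

Import GRing.Theory.
Local Open Scope ring_scope.
Local Open Scope quotient_scope.

(** * Generators and commutators of the Jordan plane *)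

Section JordanPlaneGenerators.
Variable k : fieldType.
Local Notation F := (free_alg k 'I_2).
Local Notation R := (jordan_plane k).

Definition jordan_x : R := \pi_R (free_x k).
Definition jordan_y : R := \pi_R (free_y k).

Lemma jordan_rel : jordan_x * jordan_y = jordan_y * jordan_x + jordan_y ^+ 2.
Proof.
have piM u v : \pi_R u * \pi_R v = \pi_R (u * v) :> R := rquot_mulE _ u v.
rewrite expr2 !piM -[RHS]rquot_piD; apply/rquot_eqP.
apply/ideal_genP => I _; apply.
by rewrite inE opprD addrA expr2.
Qed.

(** The words in the two generators span the free algebra, and every element
    of the quotient is the class of a combination of words. *)
Lemma jordan_plane_ind (P : R -> Prop) :
  P 1 -> (forall c u v, P u -> P v -> P (c *: u + v)) ->
  (forall u v, P u -> P v -> P (u * v)) ->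
  P jordan_x -> P jordan_y -> forall r, P r.
Proof.
move=> P1 PL PM Px Py.
have piM (u v : F) : \pi_R u * \pi_R v = \pi_R (u * v) :> R := rquot_mulE _ u v.
have piZ (c : k) (u : F) : c *: \pi_R u = \pi_R (c *: u) :> R :=
  rquot_scaleE _ c u.
have pi1 : 1 = \pi_R (1 : F) :> R := rquot_oneE _.
have pi0 : 0 = \pi_R (0 : F) :> R := esym (rquot_pi0 _).
have piD (u v : F) : \pi_R (u + v) = \pi_R u + \pi_R v :> R := rquot_piD _ u v.
have P0 : P 0 by rewrite -[0](addNr 1) -scaleN1r; apply: PL.
have Pg (i : 'I_2) : P (\pi_R (free_gen k i)).
  suff [-> | ->] : i = ord0 \/ i = ord_max by [].
  by case: i => [[|[|//]] lti]; [left | right]; apply: val_inj.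
have Pw (w : word 'I_2) : P (\pi_R (<< w >> : F)).
  elim: w => [|i w IH]; first by rewrite (_ : << _ >> = 1) // -pi1.
  rewrite (_ : << _ >> = free_gen k i * (<< w >> : F)).
    by rewrite -piM; exact: PM.
  by rewrite malgM_def fgmulUU mulr1.
elim/quotW => f; rewrite (monalgE f); elim: (finmap.enum_fset _) => [|w s IH].
  by rewrite big_nil -pi0.
rewrite big_cons piD.
rewrite (_ : << f@_w *g w >> = f@_w *: (<< w >> : F)); last first.
  by apply/malgP => v; rewrite mcoeffZ !mcoeffU mulrnAr mulr1.
by rewrite -piZ; apply: PL.
Qed.

(** The property passes to products because u y = y (u + y d) lets y travel to
    the left of any coefficient. *)
Lemma jordan_y_normal (b : R) :
  exists d, b * jordan_y = jordan_y * b + jordan_y ^+ 2 * d.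
Proof.
set y := jordan_y; move: b; apply: jordan_plane_ind.
- by exists 0; rewrite mulr1 mul1r mulr0 addr0.
- move=> c u v [d ud] [e ve]; exists (c *: d + e).
  by rewrite mulrDl mulrDr -scalerAl ud ve mulrDr -!scalerAr scalerDr addrACA.
- move=> u v [d ud] [e ve]; exists (d * v + u * e + y * d * e + d * y * e).
  have uy z : u * (y * z) = y * (u * z + y * (d * z)).
    by rewrite mulrA ud expr2 mulrDl mulrDr !mulrA.
  rewrite -mulrA ve expr2 mulrDr -!mulrA !uy -mulrDr -addrA -!mulrDr.
  by rewrite !mulrA !addrA.
- by exists 1; rewrite jordan_rel mulr1.
- by exists 0; rewrite mulr0 addr0.
Qed.

(** Modulo y the Jordan plane is the commutative ring k[x].  For fixed a, the
    elements commuting with a modulo y form a subalgebra that contains y, so it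
    is enough to test x; exchanging the roles of a and x reduces the test to
    the trivial commutator of x with itself. *)
Lemma jordan_comm_mod_y (b c : R) : exists d, b * c = c * b + jordan_y * d.
Proof.
set y := jordan_y.
have closed a : (exists d, a * jordan_x = jordan_x * a + y * d) ->
   forall c, exists d, a * c = c * a + y * d.
  move=> ax; apply: jordan_plane_ind => //.
  - by exists 0; rewrite mulr1 mul1r mulr0 addr0.
  - move=> l u v [d ud] [e ve]; exists (l *: d + e).
    by rewrite !mulrDr mulrDl -!scalerAr -scalerAl ud ve scalerDr addrACA.
  - move=> u v [d ud] [e ve]; have [g vg] := jordan_y_normal u.
    exists (d * v + u * e + y * g * e).
    have uy z : u * (y * z) = y * (u * z + y * (g * z)).
      by rewrite mulrA vg expr2 mulrDl mulrDr !mulrA.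
    rewrite mulrA ud mulrDl -!mulrA ve mulrDr uy -addrA -!mulrDr.
    by rewrite !mulrA [_ + d * v]addrC addrA.
  - have [g vg] := jordan_y_normal a; exists (y * g).
    by rewrite vg expr2 mulrA.
have swap a b' : (exists d, a * b' = b' * a + y * d) ->
   exists d, b' * a = a * b' + y * d.
  by case=> d ->; exists (- d); rewrite mulrN addrK.
have xc : forall a, exists d, jordan_x * a = a * jordan_x + y * d.
  by apply: closed; exists 0; rewrite mulr0 addr0.
by apply: closed; apply: swap.
Qed.

End JordanPlaneGenerators.

(** * Nilpotent matrices *)

Section Matrices.
Variables (k : fieldType) (n : nat).
Implicit Types X Y N : 'M[k]_n.+1.

(** The derivation [X, -] acts on k[Y] as t^2 d/dt. *)
Lemma commutator_horner_mx X Y (p : {poly k}) :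
  X * Y = Y * X + Y ^+ 2 ->
  X * horner_mx Y p = horner_mx Y p * X + horner_mx Y (p^`() * 'X^2).
Proof.
move=> XY; elim/poly_ind: p => [|p c IH].
  by rewrite deriv0 mul0r !rmorph0 mulr0 mul0r addr0.
have XcY : X * c%:M = c%:M * X by exact: scalar_mxC.
move: IH; rewrite derivMXaddC mulrDl !(rmorphD, rmorphXn, rmorphM) /=.
rewrite horner_mx_X horner_mx_C; set h := horner_mx Y p.
set h' := horner_mx Y _ => IH.
rewrite mulrDr mulrDl XcY mulrA IH mulrDl -[h * X * Y]mulrA XY mulrDr.
rewrite -[h' * Y * _]mulrA -exprS -[h' * _ * Y]mulrA -exprSr !mulrA.
by rewrite -!addrA; congr (_ + _); rewrite addrA addrC.
Qed.

(** The minimal polynomial p divides p' t^2.  With p = q t^m and q(0) != 0, the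
    factor q divides q' because it is prime to t, so q' = 0 for degree reasons,
    and in characteristic 0 the polynomial q is constant. *)
Lemma jordan_relation_nilpotent X Y :
  [pchar k] =i pred0 -> X * Y = Y * X + Y ^+ 2 -> exists m, Y ^+ m = 0.
Proof.
move=> char0 XY; set p := mxminpoly Y; have /pcharf0P nat0 := char0.
have p_neq0 : p != 0 by rewrite monic_neq0 ?mxminpoly_monic.
have p_dvd : p %| p^`() * 'X^2.
  apply: mxminpoly_min; have := commutator_horner_mx p XY.
  by rewrite mx_root_minpoly mulr0 mul0r add0r.
have [m [q]] := multiplicity_XsubC p 0.
rewrite p_neq0 polyC0 subr0 /= => q0 pE; exists m.
have q_neq0 : q != 0 by apply: contraNneq q0 => ->; rewrite root0.
have q_coprime i : coprimep q 'X^i.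
  by apply: coprimep_expr; rewrite -['X]subr0 -polyC0 coprimep_XsubC.
have q_dvd : q %| q^`().
  have : q %| p^`() * 'X^2 by apply: dvdp_trans p_dvd; rewrite pE dvdp_mulr.
  rewrite pE derivM mulrDl -(mulrA q) (dvdp_addl _ (dvdp_mulr _ (dvdpp q))).
  by rewrite -[_ * _ * _]mulrA -exprD Gauss_dvdpl.
have q'0 : q^`() = 0.
  apply: contraTeq q_dvd => q'_neq0.
  by apply/negP => /(dvdp_leq q'_neq0); rewrite leqNgt lt_size_deriv.
have [c qE] : exists c, q = c%:P.
  exists q`_0; apply/polyP => -[|i]; rewrite coefC //=.
  have /eqP := congr1 (fun r : {poly k} => r`_i) q'0.
  rewrite coef_deriv coef0 -mulr_natr mulf_eq0 => /orP[/eqP //|].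
  by rewrite nat0.
have := mx_root_minpoly Y; rewrite -/p pE rmorphM rmorphXn /=.
rewrite horner_mx_X qE horner_mx_C -[_ * _]/(c%:M *m _) mul_scalar_mx => /eqP.
rewrite scaler_eq0 => /orP[|/eqP //].
by move=> /eqP c0; rewrite qE c0 eqxx in q_neq0.
Qed.

Lemma nilpotent_left_kernel N (u : 'rV[k]_n.+1) m :
  N ^+ m = 0 -> u != 0 -> exists i, u *m N ^+ i != 0 /\ u *m N ^+ i *m N = 0.
Proof.
move=> Nm0 u0.
have ex : exists i, u *m N ^+ i == 0 by exists m; rewrite Nm0 mulmx0.
case: (ex_minnP ex) => -[|i]; first by rewrite mulmx1 (negPf u0).
rewrite exprSr -mulmxE mulmxA => /eqP ui min; exists i; split=> //.
by apply/negP => /min; rewrite ltnn.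
Qed.

Lemma mulmx_col_eq0 (C : 'M[k]_n.+1) :
  (forall v : 'cV_n.+1, C *m v = 0) -> C = 0.
Proof.
move=> C0; apply/matrixP => i j; move/matrixP/(_ i 0): (C0 (delta_mx j 0)).
by rewrite -colE !mxE.
Qed.

Lemma root_char_poly_shift (B : 'M[k]_n.+1) (a : k) :
  root (char_poly B) a -> root (char_poly (B - a%:M)) 0.
Proof.
rewrite -!eigenvalue_root_char => /eigenvalueP[v vB v0].
apply/eigenvalueP; exists v => //.
by rewrite mulmxBr mul_mx_scalar vB scale0r subrr.
Qed.

End Matrices.

(** * Fitting's lemma for elements of the image *)

Section Fitting.
Variables (k : fieldType) (R : algType k) (y : R).
Hypothesis y_normal : forall b, exists d, b * y = y * b + y ^+ 2 * d.
Hypothesis comm_mod_y : forall b c, exists d, b * c = c * b + y * d.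

(** The relation b y = y (b + y d) is applied i times; the error terms stay one
    power of y ahead. *)
Lemma expr_normal b i : exists d, b * y ^+ i = y ^+ i * b + y ^+ i.+1 * d.
Proof.
elim: i => [|i [d bE]]; first by exists 0; rewrite mulr1 mul1r mulr0 addr0.
have [e be] := y_normal b; have [f df] := y_normal d.
exists (e + d + y * f).
rewrite {1}exprSr mulrA bE mulrDl -[_ * b * y]mulrA -[_ * d * y]mulrA be df.
by rewrite !exprSr expr0 mul1r !mulrDr !mulrA !addrA.
Qed.

(** A left Ore condition for the powers of b that holds up to y^i.  The step
    from i to i + 1 gains a power of y since b commutes with y^i modulo
    y^(i+1), and with e modulo y. *)
Lemma expr_ore b c i : exists d e, b ^+ i * c = d * b + y ^+ i * e.
Proof.
elim: i => [|i [d [e bE]]]; first by exists 0, c; rewrite mul0r add0r.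
have [f bf] := expr_normal b i; have [g bg] := comm_mod_y b e.
exists (b * d + y ^+ i * e), (g + f * e).
rewrite exprS -mulrA bE mulrDr mulrA (mulrA b (y ^+ i)) bf mulrDl -!mulrA bg.
by rewrite exprSr !(mulrDr, mulrDl) !mulrA !addrA.
Qed.

Variables (n : nat) (rho : {lrmorphism R -> 'M[k]_n.+1}).
Local Notation V := (rep_module rho).

Lemma expr_ore_image b c m : rho y ^+ m = 0 ->
  exists d, rho b ^+ m *m rho c = rho d *m rho b.
Proof.
move=> ym; have [d [e bc]] := expr_ore b c m; exists d.
have := congr1 rho bc; rewrite rmorphD !rmorphM !rmorphXn /= ym mul0r addr0.
exact.
Qed.

Definition gen_ker (b : R) : {pred V} :=
  fun v => `[< exists i, rho b ^+ i *m (v : 'cV_n.+1) = 0 >].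

Lemma gen_kerP b (v : V) :
  reflect (exists i, rho b ^+ i *m (v : 'cV_n.+1) = 0) (v \in gen_ker b).
Proof. exact: asboolP. Qed.

(** If b^i u = 0, applying the Ore condition to b^i in place of b gives
    b^(i m) a = d b^i on the module, which kills u. *)
Lemma gen_ker_submod b m : rho y ^+ m = 0 -> submod_closed (gen_ker b).
Proof.
move=> ym; split=> [|a u v /gen_kerP[i bu] /gen_kerP[j bv]]; apply/gen_kerP.
  by exists 0; rewrite mulmx0.
have [d bd] := expr_ore_image (b ^+ i) a ym.
rewrite rmorphXn -exprM in bd.
exists (j + i * m)%N; rewrite mulmxDr.
have -> : rho b ^+ (j + i * m) *m (a *: u : V) = 0.
  by rewrite exprD -mulmxE -mulmxA [_ *m (a *: u)]mulmxA bd -!mulmxA bu !mulmx0.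
by rewrite add0r addnC exprD -mulmxE -mulmxA bv mulmx0.
Qed.

Lemma rho_horner b (q : {poly k}) : exists c, rho c = horner_mx (rho b) q.
Proof.
elim/poly_ind: q => [|q a [c cE]]; first by exists 0; rewrite !rmorph0.
exists (c * b + a%:A).
rewrite !rmorphD !rmorphM /= cE horner_mx_X horner_mx_C linearZ rmorph1.
by rewrite -scalemx1.
Qed.

(** Fitting's lemma.  The factors t^l and q of the characteristic polynomial of
    rho b are coprime, so their generalized kernels decompose the module.  The
    kernel at t^l cannot vanish: otherwise q would annihilate rho b, although 0
    is a root of the minimal polynomial but not of q. *)
Lemma nilpotent_of_singular m b : rho y ^+ m = 0 -> indecomposable V ->
  root (char_poly (rho b)) 0 -> exists l, rho b ^+ l = 0.
Proof.
move=> ym [_ indec] b_sing; set B := rho b in b_sing *.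
have [l [q]] := multiplicity_XsubC (char_poly B) 0.
rewrite monic_neq0 ?char_poly_monic //= polyC0 subr0 => q0 chE.
have [c cE] := rho_horner b q; rewrite -/B in cE.
have cop i j : coprimep ('X^i) (q ^+ j).
  by apply/coprimep_expl/coprimep_expr; rewrite coprimep_sym
    -['X]subr0 -polyC0 coprimep_XsubC.
(* Bezout for t^i and q^j, evaluated at B. *)
have bez i j (v : 'cV_n.+1) : exists u w,
   v = horner_mx B u *m (B ^+ i *m v) + horner_mx B w *m (rho c ^+ j *m v).
  have /Bezout_eq1_coprimepP [[u w] /= uw] := cop i j.
  exists u, w; rewrite !mulmxA -mulmxDl.
  have /(congr1 (horner_mx B)) := uw.
  by rewrite rmorphD !rmorphM !rmorphXn /= horner_mx_X rmorph1 cE !mulmxE => ->;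
    rewrite mul1mx.
have CH : B ^+ l * rho c = 0.
  by have := Cayley_Hamilton B; rewrite chE mulrC rmorphM rmorphXn /=
    horner_mx_X cE.
have BlE : B ^+ l = horner_mx B 'X^l by rewrite rmorphXn /= horner_mx_X.
have CH' : rho c * B ^+ l = 0 by rewrite -CH cE BlE; apply: comm_horner_mx2.
have ds : direct_sum (gen_ker b) (gen_ker c).
  split=> [v|v /gen_kerP[i bv] /gen_kerP[j cv]]; last first.
    by have [u [w ->]] := bez i j v; rewrite bv cv !mulmx0 addr0.
  have [u [w vE]] := bez l 1%N v.
  exists (horner_mx B w *m (rho c *m v));
    [|exists (horner_mx B u *m (B ^+ l *m v))].
  - apply/gen_kerP; exists l; rewrite 2!mulmxA mulmxE BlE.
    by rewrite (comm_horner_mx2 B 'X^l w) -mulrA -BlE CH mulr0 mul0mx.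
  - apply/gen_kerP; exists 1%N; rewrite expr1 2!mulmxA mulmxE cE
      (comm_horner_mx2 B q u).
    by rewrite -mulrA -cE CH' mulr0 mul0mx.
  - by rewrite addrC {1}vE expr1.
have [U0|V0] := indec _ _ (gen_ker_submod b ym) (gen_ker_submod c ym) ds.
  have c0 : rho c = 0.
    apply: mulmx_col_eq0 => v; apply: U0; apply/gen_kerP; exists l.
    by rewrite mulmxA mulmxE CH mul0mx.
  move: c0; rewrite cE => /mxminpoly_min/dvdpP[r qE].
  by rewrite qE rootM root_mxminpoly b_sing orbT in q0.
exists l; apply: mulmx_col_eq0 => v; apply: V0; apply/gen_kerP; exists 1%N.
by rewrite expr1 mulmxA mulmxE CH' mul0mx.
Qed.

End Fitting.

(** * Algebras with a character whose kernel is nil *)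

Section LocalAlgebra.
Variables (k : fieldType) (A : algType k) (chi : {lrmorphism A -> k^o}).
Hypothesis ker_nil : forall a, chi a = 0 -> exists m, a ^+ m = 0.

Lemma character_alg c : chi c%:A = c.
Proof. by rewrite linearZ /= rmorph1; apply: mulr1. Qed.

(** The kernel has codimension 1. *)
Lemma ker_maximal : maximal_left_ideal [pred a | chi a == 0].
Proof.
split=> [||I [[I0 IB] Il] I1 kerI a Ia].
- split=> [|a b]; last by rewrite !inE => /eqP b0; rewrite rmorphM /= b0 mulr0.
  by split=> [|a b]; rewrite !inE ?rmorph0 // => /eqP a0 /eqP b0;
    rewrite rmorphB /= a0 b0 subr0.
- by rewrite inE rmorph1 oner_eq0.
rewrite inE; apply: contraNT I1 => a0.
have a1 : a - (chi a)%:A \in I.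
  by apply: kerI; rewrite inE rmorphB /= character_alg /= subrr.
rewrite (_ : 1 = (chi a)^-1%:A * (a - (a - (chi a)%:A))); first by apply/Il/IB.
by rewrite subKr -scalerAl mul1r scalerA mulVf ?scale1r.
Qed.

(** The radical lies in the kernel by maximality of the latter.  Conversely, let
    m be a maximal left ideal and chi a = 0.  If a is not in m, then
    1 = y + b a for some y in m, and z = b a is nilpotent because chi z = 0;
    all 1 - z^j are in m, in particular 1 itself. *)
Lemma jacobson_ker a : (a \in jacobson A) = (chi a == 0).
Proof.
apply/jacobsonP/idP => [/(_ _ ker_maximal) //|/eqP a0 m mI].
have [[[m0 mB] ml] m1 mmax] := mI.
apply: contraNT m1 => am; pose I : {pred A} :=
  fun x => `[< exists2 y, y \in m & exists b, x = y + b * a >].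
have II : left_ideal I.
  split=> [|b x /asboolP[y ym [c ->]]]; last first.
    apply/asboolP; exists (b * y); first exact: ml.
    by exists (b * c); rewrite mulrDr mulrA.
  split=> [|x x' /asboolP[y ym [c ->]] /asboolP[y' ym' [c' ->]]]; apply/asboolP.
    by exists 0 => //; exists 0; rewrite mul0r addr0.
  exists (y - y'); first exact: mB.
  by exists (c - c'); rewrite mulrBl opprD addrACA.
have mI' : {subset m <= I}.
  by move=> y ym; apply/asboolP; exists y => //; exists 0; rewrite mul0r addr0.
have aI : a \in I.
  by apply/asboolP; exists 0 => //; exists 1; rewrite mul1r add0r.
have [I1|I1] := boolP (1 \in I); last by rewrite (mmax I) in am.
have /asboolP[y ym [b yE]] := I1.
have [l bl] : exists l, (b * a) ^+ l = 0.
  by apply: ker_nil; rewrite rmorphM /= a0 mulr0.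
have yE' : y = 1 - b * a by rewrite {1}yE addrK.
(* The telescoping sum of the elements z^j y, with y = 1 - z. *)
have mz j : 1 - (b * a) ^+ j \in m.
  elim: j => [|j IH]; first by rewrite subrr.
  have -> : 1 - (b * a) ^+ j.+1 = 1 - (b * a) ^+ j + (b * a) ^+ j * y.
    by rewrite yE' mulrBr mulr1 -exprSr addrA subrK.
  by apply: (left_idealD (conj (conj m0 mB) ml)) => //; apply: ml.
by have := mz l; rewrite bl subr0.
Qed.

(** The map that chi induces on A / J(A), computed on chosen representatives:
    two of them differ by an element of the kernel. *)
Definition residue (q : rquot (jacobson A)) : k^o := chi (repr q).

Lemma residue_pi a : residue (\pi_(rquot (jacobson A)) a) = chi a.
Proof.
apply/eqP; rewrite -subr_eq0 -rmorphB -jacobson_ker.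
by apply/rquot_eqP; rewrite reprK.
Qed.

Lemma residue_linear : linear residue.
Proof.
move=> c; elim/quotW => a; elim/quotW => b.
have -> : c *: \pi_(rquot (jacobson A)) a + \pi b =
          \pi_(rquot (jacobson A)) (c *: a + b).
  by rewrite rquot_piD -rquot_scaleE.
by rewrite !residue_pi linearP.
Qed.

HB.instance Definition _ :=
  GRing.isLinear.Build k (rquot (jacobson A)) k^o _ residue residue_linear.

Lemma local_algebra_of_character : local_algebra A.
Proof.
exists residue; split.
  split; first exact: etrans (congr1 residue (rquot_oneE _))
    (etrans (residue_pi 1) (rmorph1 chi)).
  elim/quotW => a; elim/quotW => b.
  have := congr1 residue (rquot_mulE (jacobson A) a b).
  by rewrite residue_pi rmorphM /= -!residue_pi.
exists (fun c => \pi_(rquot (jacobson A)) c%:A) => [|c];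
  last exact: etrans (residue_pi _) (character_alg c).
elim/quotW => a; rewrite -[X in X%:A]/(residue _) residue_pi; apply/rquot_eqP.
by rewrite jacobson_ker rmorphB /= character_alg subrr.
Qed.

End LocalAlgebra.

(** * The image of a representation with a common eigenvector *)

Section EigenCharacter.
Variables (k : fieldType) (R : algType k) (n : nat).
Variables (rho : {lrmorphism R -> 'M[k]_n.+1}) (w : 'rV[k]_n.+1) (i : 'I_n.+1).
Hypothesis wi_neq0 : w 0 i != 0.
Hypothesis w_eigen : forall r, exists a, w *m rho r = a *: w.

(** The eigenvalue of b on w, read off the coordinate i where w does not
    vanish. *)
Definition eigen_char (b : image_alg rho) : k^o := (w *m val b) 0 i / w 0 i.

Lemma eigen_charP b : w *m val b = eigen_char b *: w.
Proof.
rewrite /eigen_char; case: b => /= _ /asboolP[r <-].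
by have [a ->] := w_eigen r; rewrite mxE mulfK.
Qed.

Lemma eigen_char_uniq b (a : k) : w *m val b = a *: w -> eigen_char b = a.
Proof. by move=> wb; rewrite /eigen_char wb mxE mulfK. Qed.

Lemma eigen_char_linear : linear eigen_char.
Proof.
move=> c a b; apply: eigen_char_uniq.
have -> : val (c *: a + b) = c *: val a + val b by [].
by rewrite mulmxDr -scalemxAr !eigen_charP scalerA -scalerDl.
Qed.

Lemma eigen_char_monoid_morphism : monoid_morphism eigen_char.
Proof.
split=> [|a b]; apply: eigen_char_uniq; first by rewrite rmorph1 mulmx1 scale1r.
by rewrite rmorphM -mulmxE mulmxA eigen_charP -scalemxAl eigen_charP scalerA.
Qed.

HB.instance Definition _ :=
  GRing.isLinear.Build k (image_alg rho) k^o _ eigen_char eigen_char_linear.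
HB.instance Definition _ :=
  GRing.isMonoidMorphism.Build (image_alg rho) k^o eigen_char
    eigen_char_monoid_morphism.

(** An element with eigenvalue 0 on w is singular, so the hypothesis makes the
    kernel of the character nil. *)
Lemma local_image_of_eigenvector :
  (forall r, root (char_poly (rho r)) 0 -> exists m, rho r ^+ m = 0) ->
  local_algebra (image_alg rho).
Proof.
move=> nil; apply: (@local_algebra_of_character _ _ eigen_char) => b b0.
have wb : w *m val b = 0 by rewrite eigen_charP b0 scale0r.
have [r rE] : exists r, rho r = val b by exact: asboolP (valP b).
have [|m rm] := nil r; last first.
  by exists m; apply: val_inj; rewrite rmorphXn /= -rE rm.
rewrite -eigenvalue_root_char; apply/eigenvalueP; exists w.
  by rewrite rE wb scale0r.
by apply: contraNneq wi_neq0 => ->; rewrite mxE.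
Qed.

End EigenCharacter.

(** * Representations of the Jordan plane *)

Lemma indecomposable_iso (R : pzRingType) (M N : lmodType R) :
  module_iso M N -> indecomposable N -> indecomposable M.
Proof.
move=> [f [g fK gK]] [[z z0] indec]; split.
  exists (g z); apply: contraNneq z0 => gz0.
  by rewrite -[z]gK gz0 linear0.
have fsub (U : {pred M}) :
  submod_closed U -> submod_closed [pred x | g x \in U].
  move=> [U0 UL]; split=> [|a u v]; rewrite !inE -?[0](linear0 f) ?fK //.
  move=> Ug Vg; rewrite -[a *: u + v](_ : f (a *: g u + g v) = _).
    by rewrite fK UL.
  by rewrite linearP !gK.
move=> U V Us Vs [sumUV capUV].
have [|U0|V0] := indec _ _ (fsub _ Us) (fsub _ Vs).
- split=> [x|x Ux Vx]; last by rewrite -[x]gK (capUV (g x)) ?linear0.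
  have [u Uu [v Vv xE]] := sumUV (g x).
  exists (f u); rewrite ?inE ?fK //; exists (f v); rewrite ?inE ?fK //.
  by rewrite -linearD -xE gK.
- by left=> u Uu; apply: (can_inj fK); rewrite linear0;
  apply: U0; rewrite inE fK.
- by right=> v Vv; apply: (can_inj fK); rewrite linear0;
  apply: V0; rewrite inE fK.
Qed.

Lemma lrmorph_sub_alg (k : fieldType) (R : algType k) (n : nat)
  (rho : {lrmorphism R -> 'M[k]_n.+1}) (r : R) (a : k) :
  rho (r - a%:A) = rho r - a%:M.
Proof. by rewrite rmorphB /= rmorph_alg scalemx1. Qed.

(** The left kernel of Y is stable under the algebra since r y lies in y R.  So
    a vector u killed by Y can be multiplied by powers of X - a until X - a
    kills it too, without leaving that kernel. *)
Lemma jordan_common_eigenvector (k : fieldType) (n : nat)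
  (rho : {lrmorphism jordan_plane k -> 'M[k]_n.+1}) (a : k) m l :
  rho (jordan_y k) ^+ m = 0 -> rho (jordan_x k - a%:A) ^+ l = 0 ->
  exists2 w : 'rV[k]_n.+1, w != 0 & forall r, exists c, w *m rho r = c *: w.
Proof.
have := lrmorph_sub_alg rho (jordan_x k) a; set x' := _ - _ => xE ym xl.
have [|i [u0 uY]] := nilpotent_left_kernel (u := const_mx 1) ym.
  by apply/eqP => /matrixP/(_ 0 0)/eqP; rewrite !mxE oner_eq0.
have [j [w0 wX]] := nilpotent_left_kernel xl u0.
move: (_ *m _ ^+ i) u0 uY w0 wX => u u0 uY w0 wX.
set w := u *m _ in w0; exists w => //; apply: jordan_plane_ind.
- by exists 1; rewrite rmorph1 mulmx1 scale1r.
- move=> c r s [d wr] [e ws]; exists (c * d + e).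
  by rewrite linearP mulmxDr -scalemxAr wr ws scalerA scalerDl.
- move=> r s [d wr] [e ws]; exists (d * e).
  by rewrite rmorphM -mulmxE mulmxA wr -scalemxAl ws scalerA.
- exists a; rewrite -[rho _](subrK a%:M) -xE mulmxDr wX add0r.
  by rewrite mul_mx_scalar.
- exists 0; rewrite scale0r /w -rmorphXn -mulmxA mulmxE -rmorphM.
  have [d ->] := jordan_y_normal (x' ^+ j).
  by rewrite expr2 -mulrA -mulrDr rmorphM -mulmxE mulmxA uY mul0mx.
Qed.

Theorem corollary6p3 (k : closedFieldType) (char_k : [pchar k]%R =i pred0)
  (M : lmodType (jordan_plane k)) (M_indec : indecomposable M)
  (n : nat) (rho : {lrmorphism jordan_plane k -> 'M[k]_n.+1})
  (M_rho : module_iso (rep_module rho) M) :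
  local_algebra (image_alg rho).
Proof.
have V_indec := indecomposable_iso M_rho M_indec.
have [m ym] : exists m, rho (jordan_y k) ^+ m = 0.
  apply: (@jordan_relation_nilpotent _ _ (rho (jordan_x k))) => //.
  by rewrite -!rmorphM -rmorphXn -rmorphD jordan_rel.
have nil r : root (char_poly (rho r)) 0 -> exists l, rho r ^+ l = 0.
  exact: nilpotent_of_singular (@jordan_y_normal k)
    (@jordan_comm_mod_y k) _ _ _ r ym V_indec.
have [a aP] : exists a, root (char_poly (rho (jordan_x k))) a.
  by apply/closed_rootP; rewrite size_char_poly.
have [l xl] : exists l, rho (jordan_x k - a%:A) ^+ l = 0.
  by apply: nil; rewrite (lrmorph_sub_alg rho); apply: root_char_poly_shift.
have [w w0 wP] := jordan_common_eigenvector ym xl.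
have [i wi] : exists i, w 0 i != 0 by apply/rV0Pn.
exact: local_image_of_eigenvector wi wP nil.
Qed.
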